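(* Let $\mu$ be a Borel probability measure on the unit circle $\mathbb{T}$, and let $\hat U_0$ be the completely non-unitary contraction on $L^2(\mu)$ given by $\hat U_0=M_\xi-(\,\cdot\,,\bar\xi)_{L^2(\mu)}\mathbf{1}_\xi$. Let $\theta$ be its scalar characteristic function, i.e. the function on $\mathbb{D}$ determined by $\Theta_0(z)\bar\xi=\theta(z)\mathbf{1}_\xi$, where $\Theta_0$ is the characteristic operator function of $\hat U_0$. For $|\gamma|=1$ let $\mu_\gamma$ be the spectral measure, with respect to the vector $\mathbf{1}_\xi$, of the unitary operator $\hat U_\gamma=\hat U_0+\gamma(\,\cdot\,,\bar\xi)_{L^2(\mu)}\mathbf{1}_\xi$ on $L^2(\mu)$ (so $\mu_1=\mu$). Then $$\theta(z)=z\,\mathcal{C}_{\bar\xi\mu}(z)=\gamma z\,\mathcal{C}_{\bar\xi\mu_\gamma}(z)\qquad\text{for all } z\in\mathbb{D},\ |\gamma|=1 .$$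
   Context: $\mathbb{D}$ is the open unit disc. In $L^2(\mu)$, $\xi$ denotes the independent variable, $M_\xi$ multiplication by $\xi$, $\bar\xi$ the function $\xi\mapsto\bar\xi$, and $\mathbf{1}_\xi$ the constant function $1$. For a contraction $X$ on a Hilbert space, put $D_X=(\mathbf{I}-X^*X)^{1/2}$ and $D_{X^*}=(\mathbf{I}-XX^* )^{1/2}$; the characteristic operator function of a cnu contraction $X$ is $z\mapsto\left(-X+zD_{X^*}(\mathbf{I}-zX^* )^{-1}D_X\right)|_{\operatorname{clos}\operatorname{ran}D_X}$, with values in the operators from $\operatorname{clos}\operatorname{ran}D_X$ to $\operatorname{clos}\operatorname{ran}D_{X^*}$. For $X=\hat U_0$ these spaces are $\operatorname{span}\{\bar\xi\}$ and $\operatorname{span}\{\mathbf{1}_\xi\}$. The spectral measure $\mu_\gamma$ is the Borel measure on $\mathbb{T}$ with $\int_{\mathbb{T}}\zeta^l\,d\mu_\gamma(\zeta)=(\hat U_\gamma^l\mathbf{1}_\xi,\mathbf{1}_\xi)_{L^2(\mu)}$ for all $l\in\mathbb{Z}$. For a finite Borel measure $\tau$ on $\mathbb{T}$ and $f\in L^1(|\tau|)$, the Cauchy transform is $K(f\tau)(z)=\int_{\mathbb{T}}\frac{f(\xi)\,d\tau(\xi)}{1-\bar\xi z}$, $K\tau=K(1\cdot\tau)$, and the normalized Cauchy transform is $\mathcal{C}_{f\tau}(z)=K(f\tau)(z)/K\tau(z)$. *)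

(* Defs.v *)
From HB Require Import structures.
From mathcomp Require Import all_boot all_order all_algebra.
From mathcomp Require Import ring_quotient sesquilinear complex.
From mathcomp Require Import all_classical all_reals all_analysis.
From mathcomp Require Import measurable_realfun.

Set Implicit Arguments.
Unset Strict Implicit.
Unset Printing Implicit Defensive.

Import Order.TTheory GRing.Theory Num.Theory.
Import numFieldNormedType.Exports.

Local Open Scope classical_set_scope.
Local Open Scope ring_scope.

Local Notation Re := (@complex.Re _).
Local Notation Im := (@complex.Im _).

(* Integral of a complex-valued function, componentwise; as for Rintegral, the
   value is only meaningful when f is integrable. *)
Definition cint d (T : measurableType d) (R : realType)
    (mu : {measure set T -> \bar R}) (f : T -> R[i]) : R[i] :=
  ((\int[mu]_x Re (f x)) +i* (\int[mu]_x Im (f x)))%C.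

Section ComplexIntegral.
Context d (T : measurableType d) (R : realType).
Variable mu : {measure set T -> \bar R}.
Implicit Types f g : T -> R[i].

Definition cintegrable f :=
  mu.-integrable setT (EFin \o (Re \o f)) /\
  mu.-integrable setT (EFin \o (Im \o f)).

Lemma cintD f g : cintegrable f -> cintegrable g ->
  cint mu (f \+ g) = cint mu f + cint mu g.
Proof.
move=> [f1 f2] [g1 g2]; apply/eqP; rewrite eq_complex; apply/andP.
split; apply/eqP => /=; rewrite -[RHS]RintegralD//;
  by apply: eq_Rintegral => x _ /=; case: (f x); case: (g x).
Qed.

Lemma cintZ a f : cintegrable f -> cint mu (fun x => a * f x) = a * cint mu f.
Proof.
case: a => a b [f1 f2].
have fZ (c : R) h : mu.-integrable setT (EFin \o h) ->
    mu.-integrable setT (EFin \o (fun x => c * h x)).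
  move=> ih; rewrite (_ : _ \o _ = (fun x => (c%:E * (h x)%:E)%E)).
    exact: integrableZl.
  by apply/funext => x /=; rewrite EFinM.
apply/eqP; rewrite eq_complex; apply/andP; split; apply/eqP => /=.
- rewrite -[X in _ = X - _]RintegralZl// -[X in _ = _ - X]RintegralZl//.
  rewrite -[RHS]RintegralB//=; [|exact: fZ|exact: fZ].
  by apply: eq_Rintegral => x _; case: (f x).
- rewrite -[X in _ = X + _]RintegralZl// -[X in _ = _ + X]RintegralZl//.
  rewrite -[RHS]RintegralD//=; [|exact: fZ|exact: fZ].
  by apply: eq_Rintegral => x _; case: (f x).
Qed.

Lemma ae_eq_cint f g : measurable_fun setT (Re \o f) ->
  measurable_fun setT (Im \o f) ->
  measurable_fun setT (Re \o g) ->
  measurable_fun setT (Im \o g) ->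
  f = g %[ae mu] -> cintegrable f -> cint mu f = cint mu g.
Proof.
move=> f1 f2 g1 g2 fg [i1 i2]; rewrite /cint; congr Complex.
- rewrite /Rintegral; congr fine; apply: ae_eq_integral => //.
  + exact/measurable_EFinP.
  + exact/measurable_EFinP.
  + by move: fg; apply: filterS => x /= h /h ->.
- rewrite /Rintegral; congr fine; apply: ae_eq_integral => //.
  + exact/measurable_EFinP.
  + exact/measurable_EFinP.
  + by move: fg; apply: filterS => x /= h /h ->.
Qed.

End ComplexIntegral.

Section L2fun.
Context d (T : measurableType d) (R : realType).
Variable mu : {measure set T -> \bar R}.

(* f : T -> C is measurable with |f|^2 integrable iff its real and imaginary
   parts both belong to the real space Lfun mu 2. *)
Definition sqint : {pred T -> R[i]} := fun f =>
  ((Re \o f) \in Lfun mu 2%:E) && ((Im \o f) \in Lfun mu 2%:E).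

Let le12 : (1 <= 2%:E :> \bar R)%E. Proof. by rewrite lee_fin ler1n. Qed.

Let LfunS (f g : T -> R) a : f \in Lfun mu 2%:E -> g \in Lfun mu 2%:E ->
  (fun x => a * f x + g x) \in Lfun mu 2%:E.
Proof.
move=> Lf Lg.
have /= := Lfun_submod_closed mu le12 => -[_ h].
exact: (h a f g Lf Lg).
Qed.

Lemma sqint_submod_closed : submod_closed sqint.
Proof.
split.
  have L0 : (fun=> 0 : R) \in Lfun mu 2%:E.
    by have [] := Lfun_addr_closed mu le12.
  by apply/andP; split; exact: L0.
move=> [a b] f g /andP[f1 f2] /andP[g1 g2]; apply/andP; split.
- rewrite (_ : _ \o _ = (fun x => a * Re (f x) + (- b * Im (f x) + Re (g x)))).
    exact: (LfunS a f1 (LfunS (- b) f2 g1)).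
  apply/funext => x /=; rewrite !fctE /=.
  by case: (f x) => ? ?; case: (g x) => ? ?/=; rewrite addrA mulNr.
- rewrite (_ : _ \o _ = (fun x => a * Im (f x) + (b * Re (f x) + Im (g x)))).
    exact: (LfunS a f2 (LfunS b f1 g2)).
  apply/funext => x /=; rewrite !fctE /=.
  by case: (f x) => ? ?; case: (g x) => ? ?/=; rewrite addrA.
Qed.

HB.instance Definition _ := GRing.isSubmodClosed.Build _ _ sqint
  sqint_submod_closed.

Record L2fun := MkL2fun { L2val :> T -> R[i]; _ : L2val \in sqint }.

HB.instance Definition _ := [isSub for L2val].
HB.instance Definition _ := [Choice of L2fun by <:].
HB.instance Definition _ := [SubChoice_isSubLmodule of L2fun by <:].

Definition null : {pred L2fun} := fun f => `[< (f : T -> R[i]) = cst 0 %[ae mu] >].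

Let null_zmod_closed : zmod_closed null.
Proof.
split; first by apply/asboolP; exact: aeW.
move=> f g /asboolP f0 /asboolP g0; apply/asboolP.
move: f0 g0; apply: filterS2 => x /= f0 g0 _; move: (f0 I) (g0 I) => {}f0 {}g0.
by rewrite -[LHS]/(L2val f x - L2val g x) f0 g0 subr0.
Qed.

HB.instance Definition _ := GRing.isZmodClosed.Build _ null null_zmod_closed.

(* Classes of square-integrable functions modulo a.e. equality. *)
Definition L2 : Type := Quotient.quot null.

HB.instance Definition _ := GRing.Zmodule.on L2.

Definition L2class (f : L2fun) : L2 := \pi_(Quotient.quot null)%qT f.

Definition L2repr (u : L2) : L2fun := repr (u : Quotient.quot null).

Lemma L2reprK u : L2class (L2repr u) = u.
Proof. exact: reprK. Qed.

Lemma L2classE f g :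
  L2class f = L2class g <-> (f : T -> R[i]) = g %[ae mu].
Proof.
rewrite /L2class; split.
  move/eqP; rewrite -Quotient.idealrBE => /asboolP; apply: filterS => x /= h _.
  by apply/eqP; rewrite -subr_eq0; apply/eqP; exact: h.
move=> fg; apply/eqP; rewrite -Quotient.idealrBE; apply/asboolP.
move: fg; apply: filterS => x /= h _; apply/eqP; rewrite subr_eq0; apply/eqP; exact: h.
Qed.

Lemma L2classK f : (L2repr (L2class f) : T -> R[i]) = f %[ae mu].
Proof. by apply/L2classE; rewrite L2reprK. Qed.

Lemma L2classD f g : L2class (f + g) = L2class f + L2class g.
Proof. by rewrite /L2class raddfD. Qed.

Definition L2scale (a : R[i]) (u : L2) : L2 := L2class (a *: L2repr u).

Lemma L2classZ a f : L2class (a *: f) = L2scale a (L2class f).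
Proof.
apply/L2classE; have := L2classK f; apply: filterS => x /= h _.
by rewrite -[LHS]/(a * L2val f x) -[RHS]/(a * L2val (L2repr (L2class f)) x) h.
Qed.

Let L2scaleA a b u : L2scale a (L2scale b u) = L2scale (a * b) u.
Proof. by rewrite -[u]L2reprK -!L2classZ scalerA. Qed.

Let L2scale1 : left_id 1 L2scale.
Proof. by move=> u; rewrite -[u]L2reprK -L2classZ scale1r. Qed.

Let L2scaleDr : right_distributive L2scale +%R.
Proof.
move=> a u v; rewrite -[u]L2reprK -[v]L2reprK -L2classD -!L2classZ.
by rewrite scalerDr L2classD.
Qed.

Let L2scaleDl u : {morph L2scale^~ u : a b / a + b}.
Proof. by move=> a b; rewrite -[u]L2reprK -!L2classZ scalerDl L2classD. Qed.

HB.instance Definition _ := GRing.Zmodule_isLmodule.Build R[i] L2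
  L2scaleA L2scale1 L2scaleDr L2scaleDl.

Definition L2dot (u v : L2) : R[i] :=
  cint mu (fun x => L2repr u x * (L2repr v x)^* ).

Let sqint_meas (f : L2fun) : measurable_fun setT (Re \o f) /\
  measurable_fun setT (Im \o f).
Proof.
by case: f => f /= /andP[]; rewrite !inE => /andP[+ _] /andP[+ _]; rewrite !inE.
Qed.

Let mul_meas (f g : L2fun) :
  measurable_fun setT (Re \o (fun x => f x * (g x)^* )) /\
  measurable_fun setT (Im \o (fun x => f x * (g x)^* )).
Proof.
have [f1 f2] := sqint_meas f; have [g1 g2] := sqint_meas g.
split.
  rewrite (_ : _ \o _ = ((Re \o f) \* (Re \o g)) \+
    ((Im \o f) \* (Im \o g))).
    by apply: measurable_funD; apply: measurable_funM.
  by apply/funext => x /=; case: (f x) => ? ?; case: (g x) => ? ? /=;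
    rewrite mulrN opprK.
rewrite (_ : _ \o _ = ((Im \o f) \* (Re \o g)) \-
    ((Re \o f) \* (Im \o g))).
  by apply: measurable_funB; apply: measurable_funM.
by apply/funext => x /=; case: (f x) => ? ?; case: (g x) => ? ? /=;
  rewrite mulrN addrC.
Qed.

Lemma cintegrableM (f g : L2fun) :
  cintegrable mu (fun x => f x * (g x)^* ).
Proof.
have [/andP[f1 f2] /andP[g1 g2]] : sqint f /\ sqint g.
  by split; [case: f|case: g].
have P h k : h \in Lfun mu 2%:E -> k \in Lfun mu 2%:E ->
    mu.-integrable setT (EFin \o (h \* k)).
  by move=> ? ?; apply/Lfun1_integrable; exact: Lfun2_mul_Lfun1.
split.
  rewrite (_ : EFin \o _ = ((EFin \o ((Re \o f) \* (Re \o g))%R) \+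
    (EFin \o ((Im \o f) \* (Im \o g))%R))%E).
    by apply: integrableD => //; exact: P.
  by apply/funext => x /=; rewrite -EFinD; congr EFin;
    case: (L2val f x) => ? ?; case: (L2val g x) => ? ? /=; rewrite mulrN opprK.
rewrite (_ : EFin \o _ = ((EFin \o ((Im \o f) \* (Re \o g))%R) \-
    (EFin \o ((Re \o f) \* (Im \o g))%R))%E).
  by apply: integrableB => //; exact: P.
by apply/funext => x /=; rewrite -EFinB; congr EFin;
  case: (L2val f x) => ? ?; case: (L2val g x) => ? ? /=; rewrite mulrN addrC.
Qed.

Lemma L2dotE (f g : L2fun) :
  L2dot (L2class f) (L2class g) = cint mu (fun x => f x * (g x)^* ).
Proof.
rewrite /L2dot; apply: ae_eq_cint.
- exact: (mul_meas _ _).1.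
- exact: (mul_meas _ _).2.
- exact: (mul_meas _ _).1.
- exact: (mul_meas _ _).2.
- by move: (L2classK f) (L2classK g); apply: filterS2 => x /= hf hg _;
    rewrite hf// hg.
- exact: cintegrableM.
Qed.

Lemma L2dotPl w a u v : L2dot (a *: u + v) w = a * L2dot u w + L2dot v w.
Proof.
rewrite -[u]L2reprK -[v]L2reprK -[w]L2reprK -[_ *: _]L2classZ -L2classD !L2dotE.
rewrite -cintZ; last exact: cintegrableM.
rewrite -cintD.
- by congr cint; apply/funext => x /=; rewrite mulrA -mulrDl.
- have [i1 i2] := cintegrableM (a *: L2repr u) (L2repr w).
  by split; [move: i1|move: i2]; congr (is_true (integrable _ _ _));
    apply/funext => x /=; rewrite mulrA.
- exact: cintegrableM.
Qed.

Lemma L2dotC u v : L2dot u v = (L2dot v u)^*.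
Proof.
rewrite /L2dot /cint; apply/eqP; rewrite eq_complex; apply/andP; split; apply/eqP.
  apply: eq_Rintegral => x _ /=.
  by case: (L2val _ x) => ? ?; case: (L2val _ x) => ? ? /=; rewrite !mulrN !opprK;
    congr (_ + _); rewrite mulrC.
rewrite /= -mulN1r -RintegralZl//; last exact: (cintegrableM _ _).2.
apply: eq_Rintegral => x _ /=.
by case: (L2val _ x) => ? ?; case: (L2val _ x) => ? ? /=; rewrite mulN1r;
  rewrite !mulrN opprD opprK addrC; congr (_ + _); rewrite mulrC.
Qed.

Lemma L2dotPr w a u v : L2dot w (a *: u + v) = a^* * L2dot w u + L2dot w v.
Proof. by rewrite L2dotC L2dotPl rmorphD rmorphM (L2dotC w u) (L2dotC w v). Qed.

Lemma L2dot_gt0 u : u != 0 -> 0 < L2dot u u.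
Proof.
move=> u0; set f := L2repr u.
have [i1 _] := cintegrableM f f; have [m1 _] := mul_meas f f.
have fE x : f x * (f x)^* = ((Re (f x) ^+ 2 + Im (f x) ^+ 2) +i* 0)%C.
  by case: (L2val f x) => a b /=; apply/eqP; rewrite eq_complex /=;
    rewrite !mulrN opprK -!expr2 eqxx/= [b * a]mulrC addNr.
rewrite ltcE /=; apply/andP; split.
  apply/eqP; rewrite -[RHS](mul0r (fine (mu setT))) -Rintegral_cst//.
  by apply: eq_Rintegral => x _; rewrite fE.
have h0 x : 0 <= Re (f x * (f x)^* ) by rewrite fE/= addr_ge0// sqr_ge0.
rewrite lt_neqAle Rintegral_ge0 ?andbT//; apply/eqP => I0.
move/negP : u0; apply; apply/eqP.
rewrite -[u]L2reprK -/f -[RHS](@raddf0 _ _ \pi_(Quotient.quot null)%qT).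
apply/L2classE.
have : (\int[mu]_x `|(Re (f x * (f x)^* ))%:E| = 0)%E.
  under eq_integral do rewrite gee0_abs ?lee_fin//.
  by rewrite -[LHS]fineK ?(integrable_fin_num _ i1)// -/(Rintegral _ _ _) -I0.
move=> Iabs.
have mE : measurable_fun setT (fun x => (Re (f x * (f x)^* ))%:E).
  exact/measurable_EFinP.
move: ((ae_eq_integral_abs mu measurableT mE).1 Iabs).
apply: filterS => x /= /(_ I) h _; have {h}/eqP := EFin_inj h.
rewrite fE /=.
rewrite paddr_eq0 ?sqr_ge0// !sqrf_eq0 => /andP[/eqP a0 /eqP b0].
by rewrite -[RHS]/((0 +i* 0)%C : R[i]); case: (L2val f x) a0 b0 => ? ? /= -> ->.
Qed.


Let L2dot_bilinear : bilinear_for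
  (GRing.Scale.Law.clone _ _ *%R _)
  (GRing.Scale.Law.clone _ _ (Num.conj \; *%R) _) L2dot.
Proof.
split=> [w|w] a u v /=; first exact: L2dotPl.
exact: L2dotPr.
Qed.

HB.instance Definition _ :=
  bilinear_isBilinear.Build R[i] L2 L2 R[i] _ _ L2dot L2dot_bilinear.

Let L2dot_hermitian u v : L2dot u v = (-1) ^+ false * (L2dot v u)^*.
Proof. by rewrite expr0 mul1r L2dotC. Qed.

HB.instance Definition _ := isHermitianSesquilinear.Build R[i] L2 false Num.conj
  L2dot L2dot_hermitian.
HB.instance Definition _ := isDotProduct.Build R[i] L2 L2dot L2dot_gt0.

End L2fun.

(* Operators on a complex space V with inner product dot, linear in its first
   argument. The adjoint, positive square root and inverse are selected by
   description: each is unique when it exists, and the selected value is the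
   zero map otherwise. *)
Section Operators.
Context (C : numClosedFieldType) (V : lmodType C).
Variable dot : {dot V for (@Num.conj C)}.
Implicit Types X : V -> V.

Definition hnorm (x : V) : C := sqrtC (dot x x).

Definition bounded_op X := exists M : C, forall x, hnorm (X x) <= M * hnorm x.

(* V being complex, this positivity condition forces X to be symmetric. *)
Definition positive_op X :=
  [/\ linear X, bounded_op X & forall x, 0 <= dot (X x) x].

Definition adjoint X : V -> V :=
  xget (fun=> 0) [set Y | forall x y, dot (X x) y = dot x (Y y)].

Definition sqrt_op X : V -> V :=
  xget (fun=> 0) [set D | positive_op D /\ forall x, D (D x) = X x].

Definition inv_op X : V -> V :=
  xget (fun=> 0) [set Y | cancel X Y /\ cancel Y X].

Definition defect X : V -> V := sqrt_op (fun x => x - adjoint X (X x)).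

Definition defect_adj X : V -> V := sqrt_op (fun x => x - X (adjoint X x)).

Definition clos_ran X : set V :=
  [set y | forall e : C, 0 < e -> exists x, hnorm (y - X x) < e].

(* The characteristic function at z is an operator defined on
   clos ran (defect X); patch extends it by 0 outside that subspace. Its values
   lie in clos ran (defect_adj X) but are typed in V. *)
Definition charop X (z : C) : V -> V :=
  patch (fun=> 0) (clos_ran (defect X)) (fun x =>
    - X x +
    z *: defect_adj X (inv_op (fun y => y - z *: adjoint X y) (defect X x))).

Definition zpow_op X (l : int) : V -> V :=
  match l with
  | Posz n => iter n X
  | Negz n => iter n.+1 (inv_op X)
  end.

End Operators.

Definition circle (R : realType) : Type :=
  set_type [set z : R[i]^o | `|z| = 1].

Lemma circle1_subproof (R : realType) : 1 \in [set z : R[i]^o | `|z| = 1].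
Proof. by rewrite inE /= normr1. Qed.

HB.instance Definition _ (R : realType) := Topological.on (circle R).
HB.instance Definition _ (R : realType) :=
  isPointed.Build (circle R) (exist _ 1 (circle1_subproof R)).

(* The unit circle with its Borel sigma-algebra for the subspace topology. *)
Definition torus (R : realType) : Type :=
  g_sigma_algebraType (@open (circle R)).
HB.instance Definition _ (R : realType) := Measurable.on (torus R).

(* The independent variable on the circle, as a complex-valued function. *)
Definition xi (R : realType) (x : torus R) : R[i] := set_val (x : circle R).

Section Torus.
Variable R : realType.

Lemma norm_xi (x : torus R) : `|xi x| = 1.
Proof. exact: (@set_valP _ _ (x : circle R)). Qed.

Lemma normc_ge_Im (z : R[i]) : (`|Im z|%:C)%C <= `|z|.
Proof.
by rewrite normc_def lecR -sqrtr_sqr ler_wsqrtr// lerDr sqr_ge0.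
Qed.

Lemma measurable_torus (p : R[i] -> R) :
  (forall z w : R[i], (`|p z - p w|%:C)%C <= `|z - w|) ->
  measurable_fun setT (p \o @xi R).
Proof.
move=> pL; apply: (measurability _ (RGenOInfty.measurableE R)) => _ [_ [a ->] <-].
rewrite setTI; apply: sub_sigma_algebra; rewrite /=.
exists [set z | a < p z] => /=; last first.
  by apply/seteqP; split => x /=; rewrite in_itv/= andbT.
rewrite openE => z /= az; apply/nbhs_ballP.
exists ((p z - a)%:C)%C; first by rewrite /= ltcR subr_gt0.
move=> w; rewrite /ball /= => /(le_lt_trans (pL z w)).
by rewrite ltcR => /(le_lt_trans (ler_norm _)); rewrite ltrD2l ltrN2.
Qed.

Lemma measurable_Re_xi : measurable_fun setT (Re \o @xi R).
Proof.
apply: measurable_torus => -[a b] [a' b'].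
exact: (normc_ge_Re ((a - a') +i* (b - b'))%C).
Qed.

Lemma measurable_Im_xi : measurable_fun setT (Im \o @xi R).
Proof.
apply: measurable_torus => -[a b] [a' b'].
exact: (normc_ge_Im ((a - a') +i* (b - b'))%C).
Qed.

Lemma Lfun2M d (T : measurableType d) (mu : {measure set T -> \bar R})
    (h f : T -> R) : measurable_fun setT h -> (forall x, `|h x| <= 1) ->
  f \in Lfun mu 2%:E -> (fun x => h x * f x) \in Lfun mu 2%:E.
Proof.
move=> mh h1 Lf; have /andP[] := Lf; rewrite !inE /= => mf Ff.
apply/andP; split; first by rewrite inE /=; exact: measurable_funM.
rewrite inE /= /finite_norm unlock /Lnorm poweR_lty//.
have /integrableP[mf2 f2y] := Lfun_integrable (ler1n _ 2) Lf.
apply: le_lt_trans f2y; apply: ge0_le_integral => //.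
- by move=> x _; rewrite poweR_ge0.
- apply/(@measurable_EFinP _ _ _ _ (fun x => `|h x * f x| `^ 2)).
  apply: (@measurableT_comp _ _ _ _ _ _ (fun x : R => x `^ 2)%R) => //.
  by apply: measurableT_comp => //; exact: measurable_funM.
- exact: measurableT_comp.
- move=> x _; rewrite /= lee_fin; apply: le_trans (ler_norm _).
  by apply: ge0_ler_powR; rewrite ?nnegrE// normrM ler_piMl.
Qed.

Let Re_le1 (x : torus R) : `|Re (xi x)| <= 1.
Proof. by rewrite -lecR (le_trans (normc_ge_Re _))// norm_xi. Qed.

Let Im_le1 (x : torus R) : `|Im (xi x)| <= 1.
Proof. by rewrite -lecR (le_trans (normc_ge_Im _))// norm_xi. Qed.

Variable mu : probability (torus R) R.

Let LfunD (f g : torus R -> R) : f \in Lfun mu 2%:E -> g \in Lfun mu 2%:E ->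
  f \+ g \in Lfun mu 2%:E.
Proof. by apply: (Lfun_addr_closed mu _).2; rewrite lee_fin ler1n. Qed.

Let LfunN (f : torus R -> R) : f \in Lfun mu 2%:E -> \- f \in Lfun mu 2%:E.
Proof. by apply: (Lfun_oppr_closed (mu := mu)); rewrite lee_fin ler1n. Qed.

Let LfunX (p : R[i] -> R) (f : torus R -> R) :
  measurable_fun setT (p \o @xi R) -> (forall x, `|p (xi x)| <= 1) ->
  f \in Lfun mu 2%:E -> (fun x => p (xi x) * f x) \in Lfun mu 2%:E.
Proof. by move=> mp p1; exact: Lfun2M. Qed.

Lemma sqint_xiM f : f \in sqint mu -> (fun x => xi x * f x) \in sqint mu.
Proof.
move=> /andP[f1 f2]; apply/andP; split.
- rewrite (_ : _ \o _ = (fun x => Re (xi x) * Re (f x)) \+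
      (\- (fun x => Im (xi x) * Im (f x)))).
    apply: LfunD; first exact: (LfunX measurable_Re_xi).
    by apply: LfunN; exact: (LfunX measurable_Im_xi).
  by apply/funext => x /=; case: (xi x) => ? ?; case: (f x).
- rewrite (_ : _ \o _ = (fun x => Re (xi x) * Im (f x)) \+
      (fun x => Im (xi x) * Re (f x))).
    by apply: LfunD; [exact: (LfunX measurable_Re_xi)|
                      exact: (LfunX measurable_Im_xi)].
  by apply/funext => x /=; case: (xi x) => ? ?; case: (f x).
Qed.

Lemma sqint_one : (fun=> 1) \in sqint mu.
Proof. by apply/andP; split; exact: Lfun_cst. Qed.

Lemma sqint_xibar : (fun x => (xi x)^* ) \in sqint mu.
Proof.
have /andP[x1 x2] := sqint_xiM sqint_one.
apply/andP; split.
- rewrite (_ : _ \o _ = Re \o (fun x => xi x * 1))//.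
  by apply/funext => x /=; rewrite mulr1; case: (xi x).
- rewrite (_ : _ \o _ = \- (Im \o (fun x => xi x * 1))); first exact: LfunN.
  by apply/funext => x /=; rewrite mulr1; case: (xi x).
Qed.

Definition one_xi : L2 mu := L2class (MkL2fun sqint_one).

Definition xi_bar : L2 mu := L2class (MkL2fun sqint_xibar).

Definition M_xi (u : L2 mu) : L2 mu :=
  L2class (MkL2fun (sqint_xiM (valP (L2repr u)))).

Definition U0 (u : L2 mu) : L2 mu := M_xi u - L2dot u xi_bar *: one_xi.

Definition Ugamma (g : R[i]) (u : L2 mu) : L2 mu :=
  U0 u + (g * L2dot u xi_bar) *: one_xi.

(* The scalar w with Theta_0(z) xi_bar = w *: one_xi, unique as one_xi != 0. *)
Definition theta (z : R[i]) : R[i] :=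
  xget 0 [set w | charop (@L2dot _ _ _ mu) U0 z xi_bar = w *: one_xi].

End Torus.

Definition is_spectral_measure (R : realType) (V : lmodType R[i])
    (dot : {dot V for (@Num.conj R[i])}) (X : V -> V) (v : V)
    (nu : {measure set (torus R) -> \bar R}) :=
  forall l : int, cint nu (fun x => xi x ^ l) = dot (zpow_op X l v) v.

Definition cauchyT (R : realType) (tau : {measure set (torus R) -> \bar R})
    (f : torus R -> R[i]) (z : R[i]) : R[i] :=
  cint tau (fun x => f x / (1 - (xi x)^* * z)).

Definition ncauchyT (R : realType) (tau : {measure set (torus R) -> \bar R})
    (f : torus R -> R[i]) (z : R[i]) : R[i] :=
  cauchyT tau f z / cauchyT tau (fun=> 1) z.

(* Main.v *)
(* Write X for U0 and K for K mu. Both defect operators of X are rank-one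
   projections, onto the lines of xi_bar and of 1, so that
   theta(z) = z (w, 1) where (I - z X^* ) w = xi_bar. Since X^* is
   multiplication by the conjugate of xi minus a rank-one operator, this
   equation is solved with the multiplication by 1 / (1 - conj(xi) z), giving
   (w, 1) = K(conj(xi) mu)(z) / K(z); the denominator is nonzero because the
   real part of 1 / (1 - conj(xi) z) is at least 1/2.

   For the second equality let a = conj(z) and w = 1 / (1 - a xi) in L2(mu).
   Then (I - a U_gamma) w is an explicit multiple k of 1. Iterating
   w = k 1 + a U_gamma w expands (w, 1) = conj(K(z)) along the moments
   (U_gamma^n 1, 1) of mu_gamma, with remainders of order |a|^N because
   U_gamma is isometric; the conjugate of K(mu_gamma)(z) has the same expansion
   up to the factor k. Hence conj(K) = k conj(K mu_gamma), and the claim follows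
   from z K(conj(xi) tau) = K tau - tau(T). *)

Require Import Defs.
From mathcomp Require Import all_boot all_order all_algebra complex.
From mathcomp Require Import sesquilinear ring.
From mathcomp Require Import all_classical all_reals all_analysis.
From mathcomp Require Import measurable_realfun.

Import Order.TTheory GRing.Theory Num.Theory.
Import numFieldNormedType.Exports.
Local Open Scope ring_scope.

Set Implicit Arguments.
Unset Strict Implicit.
Unset Printing Implicit Defensive.

(** * Rank-one perturbations in an inner product space *)

Section DotSpace.
Context (C : numClosedFieldType) (V : lmodType C).
Variable dot : {dot V for (@Num.conj C)}.

Let dotDl x y z : dot (x + y) z = dot x z + dot y z.
Proof. exact: linearDl. Qed.
Let dotBl x y z : dot (x - y) z = dot x z - dot y z.
Proof. exact: linearBl. Qed.
Let dotDr x y z : dot z (x + y) = dot z x + dot z y.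
Proof. exact: linearDr. Qed.
Let dotBr x y z : dot z (x - y) = dot z x - dot z y.
Proof. exact: linearBr. Qed.
Let dotZl a x z : dot (a *: x) z = a * dot x z. Proof. exact: linearZl_LR. Qed.
Let dotZr a x z : dot z (a *: x) = a^* * dot z x.
Proof. exact: linearZr_LR. Qed.
Let dotC x y : dot x y = (dot y x)^*.
Proof. by rewrite hermC expr0 mul1r. Qed.
Let dotNl x z : dot (- x) z = - dot x z. Proof. exact: linearNl. Qed.
Let dotNr x z : dot z (- x) = - dot z x. Proof. exact: linearNr. Qed.
Let dotE := (dotDl, dotDr, dotNl, dotNr, dotZl, dotZr).

(** The gap is the squared norm of the component of [u] orthogonal to [e]. *)
Lemma bessel1 e u : dot e e = 1 -> `|dot u e| ^+ 2 <= dot u u.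
Proof.
move=> e1; rewrite -subr_ge0.
suff -> : dot u u - `|dot u e| ^+ 2 = dot (u - dot u e *: e) (u - dot u e *: e).
  exact: dnorm_ge0.
by rewrite !dotE e1 (dotC e u) normCK mulr1; ring.
Qed.

Lemma dot_ext y y' : (forall x, dot x y = dot x y') -> y = y'.
Proof.
move=> h; apply/eqP; rewrite -subr_eq0 -(dnorm_eq0 dot).
by rewrite dotBr h subrr.
Qed.

(** An adjoint is unique because the inner product is definite, so any candidate is the one selected
    by description. *)
Lemma adjointE {X Y : V -> V} :
  (forall x y, dot (X x) y = dot x (Y y)) -> adjoint dot X = Y.
Proof.
move=> XY; apply/funext => y; apply: dot_ext => x; rewrite -XY.
have : [set Y | forall x y, dot (X x) y = dot x (Y y)]%classic (adjoint dot X).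
  exact: (@xgetI _ _ _ Y).
by move=> /(_ x y) <-.
Qed.

Definition line_proj e (x : V) : V := dot x e *: e.

Lemma positive_line_proj e : dot e e = 1 -> positive_op dot (line_proj e).
Proof.
move=> e1; split.
- by move=> a x y; rewrite /line_proj !dotE scalerDl scalerA.
- exists 1 => x; rewrite mul1r /hnorm ler_sqrtC ?nnegrE ?dnorm_ge0//.
  by rewrite /line_proj dnormZ e1 mulr1 bessel1.
- by move=> x; rewrite /line_proj dotZl (dotC e) -normCK exprn_ge0.
Qed.

(* If D D = P, then D vanishes on the kernel of P: for P x = 0 and y = D x one
   has D y = 0, and t |-> dot (D (x + t y)) (x + t y) is affine in the conjugate
   of t with slope dot y y, hence not always nonnegative unless y = 0. *)
Lemma positive_sqrt_line_proj e D : dot e e = 1 -> positive_op dot D ->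
  (forall x, D (D x) = line_proj e x) -> D = line_proj e.
Proof.
move=> e1 [linD _ posD] DD.
have DDe a x y : D (a *: x + y) = a *: D x + D y by rewrite linD.
have kerD x : dot x e = 0 -> D x = 0.
  move=> xe; apply/eqP; rewrite -(dnorm_eq0 dot); apply/negPn/negP => y0.
  have Dy : D (D x) = 0 by rewrite DD /line_proj xe scale0r.
  (* With this [t] the affine expression takes the value [-1]. *)
  pose t := (- (1 + dot (D x) x) / dot (D x) (D x))^*.
  have := posD (t *: D x + x).
  rewrite DDe Dy scaler0 add0r !dotE /t conjCK mulfVK//.
  by rewrite opprD addrNK lerNr oppr0 lt_geF ?ltr01.
have DPx x : D x = dot x e *: D e.
  rewrite -[in LHS](subrKC (line_proj e x) x) /line_proj DDe.
  by rewrite [D (x - _)]kerD ?addr0// !dotE e1 mulr1 subrr.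
have De2 : dot (D e) e ^+ 2 = 1.
  have := DD e; rewrite (DPx (D e)) /line_proj e1 scale1r => DDe1.
  by rewrite expr2 -dotZl DDe1.
have De : D e = e.
  have := DD e; rewrite (DPx (D e)) /line_proj e1 scale1r.
  (* Positivity of [D] rules out the root [-1]. *)
  by move/eqP: De2; rewrite sqrp_eq1 ?posD// => /eqP ->; rewrite scale1r.
by apply/funext => x; rewrite DPx De.
Qed.

(** A projection is idempotent and positive, hence its own positive square root. *)
Lemma sqrt_op_line_proj e : dot e e = 1 ->
  sqrt_op dot (line_proj e) = line_proj e.
Proof.
move=> e1; apply: xget_unique => [|D [posD DD]].
  split=> [|x]; first exact: positive_line_proj.
  by rewrite /line_proj dotZl e1 mulr1.
exact: positive_sqrt_line_proj.
Qed.

(** * Rank-one perturbations of a unitary operator: adjoint and defects *)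

Section RankOnePerturbation.
Variables (M Ms : V -> V) (e : V).
Hypothesis MK : cancel M Ms.
Hypothesis MsK : cancel Ms M.
Hypothesis MP : forall a x y, M (a *: x + y) = a *: M x + M y.
Hypothesis MsP : forall a x y, Ms (a *: x + y) = a *: Ms x + Ms y.
Hypothesis dotM : forall x y, dot (M x) y = dot x (Ms y).
Hypothesis e1 : dot e e = 1.

Let eb := Ms e.
Let X x := M x - dot x eb *: e.
Let Xs x := Ms x - dot x e *: eb.

Let MZ a x : M (a *: x) = a *: M x.
Proof.
have M0 : M 0 = 0 by have := MP (-1) 0 0; rewrite !scaleN1r oppr0 !addr0 addNr.
by have := MP a x 0; rewrite M0 !addr0.
Qed.

Let MsZ a x : Ms (a *: x) = a *: Ms x.
Proof. by apply: (can_inj MK); rewrite MZ !MsK. Qed.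

Let MsB x y : Ms (x - y) = Ms x - Ms y.
Proof. by rewrite addrC -scaleN1r MsP scaleN1r addrC. Qed.

Let eb1 : dot eb eb = 1. Proof. by rewrite -dotM MsK. Qed.

Lemma adjoint_pert : adjoint dot X = Xs.
Proof.
apply: adjointE => x y; rewrite /X /Xs !dotE dotM (dotC e y); ring.
Qed.

(** The range of [X] is orthogonal to [e], so the rank-one term of [Xs] vanishes on it and
    [Xs (X x) = x - line_proj eb x]. *)
Lemma defect_pert : defect dot X = line_proj eb.
Proof.
rewrite /defect -sqrt_op_line_proj//; congr sqrt_op; apply/funext => x.
rewrite adjoint_pert /Xs /X MsB MK MsZ -/eb !dotE e1 mulr1 dotM -/eb.
by rewrite subrr scale0r subr0 subKr.
Qed.

Lemma defect_adj_pert : defect_adj dot X = line_proj e.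
Proof.
rewrite /defect_adj -[RHS]sqrt_op_line_proj//; congr sqrt_op; apply/funext => x.
(* Dually, the range of [Xs] is orthogonal to [eb]. *)
have Xs_eb : dot (Xs x) eb = 0.
  by rewrite /Xs dotBl dotZl eb1 mulr1 -dotM MsK subrr.
rewrite adjoint_pert /X Xs_eb scale0r subr0.
have -> : M (Xs x) = x - dot x e *: e.
  by rewrite /Xs addrC -scaleNr MP !MsK scaleNr addrC.
by rewrite subKr.
Qed.

(** * The characteristic function in terms of the resolvent of [Ms] *)

Section Resolvent.
Variables (z : C) (S : V -> V).
Hypothesis SP : forall a x y, S (a *: x + y) = a *: S x + S y.
Hypothesis SK : forall x, S (x - z *: Ms x) = x.
Hypothesis KS : forall x, S x - z *: Ms (S x) = x.
Hypothesis S0 : dot (S e) e != 0.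

Let SZ a x : S (a *: x) = a *: S x.
Proof.
have S00 : S 0 = 0 by have := SP (-1) 0 0; rewrite !scaleN1r oppr0 !addr0 addNr.
by have := SP a x 0; rewrite S00 !addr0.
Qed.

Let SMs x : S (Ms x) = Ms (S x).
Proof. by rewrite -[in LHS](KS x) MsB MsZ SK. Qed.

(** This is [S e = e + z S eb] paired with [e]. It turns the equation for [c = (w, e)] into
    [c (S e, e) = (S y, e)]. *)
Let dotSe : dot (S e) e = 1 + z * dot (S eb) e.
Proof. by rewrite SMs -{1}(subrK (z *: Ms (S e)) (S e)) KS dotDl dotZl e1. Qed.

Let T x := x - z *: Xs x.

(* (I - z X^* ) w = y reads (I - z Ms) w = y - z (w, e) eb, so that w is
   recovered from the number c = (w, e), itself determined by applying S and
   pairing with e. *)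
Let Ti y := S (y - (z * (dot (S y) e / dot (S e) e)) *: eb).

Let TiK : cancel T Ti.
Proof.
move=> x.
have Tx : T x = (z * dot x e) *: eb + (x - z *: Ms x).
  by rewrite /T /Xs scalerBr scalerA opprB addrCA.
have ST : S (T x) = (z * dot x e) *: S eb + x by rewrite Tx SP SK.
have cE : dot (S (T x)) e / dot (S e) e = dot x e.
  rewrite ST dotDl dotZl -[_ + _]/(_ + dot x e).
  by apply/(canLR (mulfK S0)); rewrite dotSe; ring.
by rewrite /Ti cE Tx addrAC subrr add0r SK.
Qed.

Let SB x y : S (x - y) = S x - S y.
Proof. by rewrite addrC -scaleN1r SP scaleN1r addrC. Qed.

Let dotTi y : dot (Ti y) e = dot (S y) e / dot (S e) e.
Proof.
rewrite /Ti SB SZ dotBl dotZl; move: S0; rewrite dotSe => K0; field.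
exact: K0.
Qed.

Let TiE y : T (Ti y) = y.
Proof.
rewrite /T /Xs dotTi.
by rewrite scalerBr scalerA opprB addrCA /Ti KS subrKC.
Qed.

(** Since [X eb = 0], only the resolvent term survives. The defect operators fix [eb] on the right
    and project onto [e] on the left, which leaves the number [(Ti eb, e)]. *)
Lemma charop_pert :
  charop dot X z eb = (z * (dot (S eb) e / dot (S e) e)) *: e.
Proof.
(* [eb] is its own image under the defect operator, so the default value of [patch] is not taken. *)
rewrite /charop /patch ifT; last first.
  rewrite inE /clos_ran /= => eps eps0; exists eb.
  by rewrite defect_pert /line_proj eb1 scale1r subrr /hnorm linear0r sqrtC0.
have -> : inv_op (fun y => y - z *: adjoint dot X y) = Ti.
  rewrite adjoint_pert -/T.
  apply: xget_unique => [|Y [TY YT]]; first by split; [exact: TiK|exact: TiE].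
  by apply/funext => y; rewrite -[in LHS](TiE y) TY.
rewrite defect_pert defect_adj_pert /line_proj eb1 scale1r.
have -> : X eb = 0 by rewrite /X eb1 scale1r /eb MsK subrr.
rewrite oppr0 add0r scalerA; by rewrite dotTi.
Qed.

End Resolvent.

(** * Unimodular perturbations and iteration of their resolvent equation *)

Section Unitary.
Variables (g : C) (U : V -> V).
Hypothesis g1 : `|g| = 1.
Hypothesis UE : forall x, U x = M x + ((g - 1) * dot x eb) *: e.

(** As [(x, eb) = (M x, e)], the vector [U x] is [M x] with its [e]-component multiplied by the
    unimodular [g]. *)
Lemma isometry_pert x : dot (U x) (U x) = dot x x.
Proof.
have gg : g * g^* = 1 by rewrite -normCK g1 expr1n.
rewrite UE !dotE e1 mulr1 (dotC e) dotM MK.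
rewrite dotM -/eb rmorphM rmorphB rmorph1.
transitivity (dot x x + (dot x eb * (dot x eb)^* ) * (g * g^* - 1)); first ring.
by rewrite gg subrr mulr0 addr0.
Qed.

Let UP a x y : U (a *: x + y) = a *: U x + U y.
Proof.
rewrite !UE MP dotDl dotZl mulrDr scalerDl scalerDr scalerA.
by rewrite mulrCA addrACA.
Qed.

Variables (a : C) (w : V).
Hypothesis wE : w - a *: M w = e.

Let k := 1 - (g - 1) * (dot w e - 1).

(** Pairing [wE] with [e] gives [a (w, eb) = (w, e) - 1], so replacing [M] by [U] in [wE] changes
    only the multiple of [e]. *)
Let wU : w = k *: e + a *: U w.
Proof.
have aw : a * dot w eb = dot w e - 1.
  have aMw : a *: M w = w - e by rewrite -wE subKr.
  by rewrite -dotM -dotZl aMw dotBl e1.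
rewrite UE scalerDr scalerA mulrCA aw /k scalerBl scale1r.
by rewrite addrCA addrNK -wE subrKC.
Qed.

Lemma resolvent_expansion N :
  dot w e = k * (\sum_(n < N) a ^+ n * dot (iter n U e) e) +
            a ^+ N * dot (iter N U w) e.
Proof.
have iterP n b x y : iter n U (b *: x + y) = b *: iter n U x + iter n U y.
  by elim: n => //= n ->; rewrite UP.
have iterZ n b x : iter n U (b *: x) = b *: iter n U x.
  have U0 : iter n U 0 = 0.
    by have := iterP n (-1) 0 0; rewrite !scaleN1r oppr0 !addr0 addNr.
  by have := iterP n b x 0; rewrite U0 !addr0.
elim: N => [|N IHN]; first by rewrite big_ord0 mulr0 add0r expr0 mul1r.
(* One substitution of [wU] inside the remainder produces the next term. *)
rewrite [LHS]IHN big_ord_recr /= [in LHS]wU iterP iterZ -iterSr.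
rewrite dotDl !dotZl exprS /=; ring.
Qed.

Lemma resolvent_remainder N : `|dot (iter N U w) e| ^+ 2 <= dot w w.
Proof.
apply: le_trans (bessel1 _ e1) _.
by elim: N => //= N IHN; rewrite isometry_pert.
Qed.

End Unitary.
End RankOnePerturbation.
End DotSpace.

(** * Bounded measurable complex functions *)

(** Used to identify two expansions whose remainders decay geometrically. Nonnegative complex
    numbers are real, so the limit is taken in [R]. *)
Lemma geometric_bound_eq0 (R : realType) (d r B : R[i]) : 0 <= d -> 0 <= r ->
  r < 1 -> (forall n, d <= r ^+ n * B) -> d = 0.
Proof.
move=> d0 r0 r1 h.
have B0 : 0 <= B by apply: le_trans d0 _; have := h 0%N; rewrite expr0 mul1r.
have dE := RRe_real (ger0_real d0); have rE := RRe_real (ger0_real r0).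
have BE := RRe_real (ger0_real B0).
move: (complex.Re d) (complex.Re r) (complex.Re B) dE rE BE.
move=> d' r' B' dE rE BE.
move: h d0 r0 r1; rewrite -{}dE -{}rE -{}BE => h.
rewrite !ler0c ltcR => d0 r0 r1.
suff d0' : d' <= 0 by congr _%:C%C; apply/eqP; rewrite eq_le d0' d0.
have cv : (geometric B' r' @ \oo --> (0 : R))%classic.
  by apply: cvg_geometric; rewrite ger0_norm.
rewrite -(cvg_lim (@Rhausdorff R) cv).
apply: limr_ge; first by apply/cvg_ex; exists 0.
by apply: nearW => n; have := h n; rewrite -rmorphXn -rmorphM lecR mulrC.
Qed.

Section BoundedMeasurable.
Context d (T : measurableType d) (R : realType).
Implicit Types f g : T -> R[i].

(** Such functions are multipliers of L2 and integrable against every finite measure, so one class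
    serves both [mu] and the spectral measures. *)
Definition bmeas f := [/\ measurable_fun setT (fun x => complex.Re (f x)),
  measurable_fun setT (fun x => complex.Im (f x)) &
  exists B : R, forall x, `|f x| <= B%:C%C].

Lemma bmeas_cst c : bmeas (fun=> c).
Proof.
split; [exact: measurable_cst..|].
by exists (complex.Re `|c|) => x; rewrite RRe_real.
Qed.

Lemma bmeasD f g : bmeas f -> bmeas g -> bmeas (fun x => f x + g x).
Proof.
move=> [f1 f2 [B fB]] [g1 g2 [C gC]]; split.
- rewrite (_ : (fun _ => _) =
    (fun x => complex.Re (f x)) \+ (fun x => complex.Re (g x))).
    exact: measurable_funD.
  by apply/funext => x /=; case: (f x); case: (g x).
- rewrite (_ : (fun _ => _) =
    (fun x => complex.Im (f x)) \+ (fun x => complex.Im (g x))).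
    exact: measurable_funD.
  by apply/funext => x /=; case: (f x); case: (g x).
- by exists (B + C) => x; rewrite rmorphD (le_trans (ler_normD _ _))// lerD.
Qed.

Lemma bmeasM f g : bmeas f -> bmeas g -> bmeas (fun x => f x * g x).
Proof.
move=> [f1 f2 [B fB]] [g1 g2 [C gC]]; split.
- rewrite (_ : (fun _ => _) =
    ((fun x => complex.Re (f x)) \* (fun x => complex.Re (g x))) \-
    ((fun x => complex.Im (f x)) \* (fun x => complex.Im (g x)))).
    by apply: measurable_funB; exact: measurable_funM.
  by apply/funext => x /=; case: (f x) => ? ?; case: (g x).
- rewrite (_ : (fun _ => _) =
    ((fun x => complex.Re (f x)) \* (fun x => complex.Im (g x))) \+
    ((fun x => complex.Im (f x)) \* (fun x => complex.Re (g x)))).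
    by apply: measurable_funD; exact: measurable_funM.
  by apply/funext => x /=; case: (f x) => ? ?; case: (g x).
- by exists (B * C) => x; rewrite rmorphM normrM ler_pM.
Qed.

Lemma bmeas_conj f : bmeas f -> bmeas (fun x => (f x)^*).
Proof.
move=> [f1 f2 [B fB]]; split.
- rewrite (_ : (fun _ => _) = (fun x => complex.Re (f x)))//.
  by apply/funext => x; case: (f x).
- rewrite (_ : (fun _ => _) = (fun x => - complex.Im (f x))).
    exact: measurableT_comp.
  by apply/funext => x; case: (f x).
- by exists B => x; rewrite norm_conjC.
Qed.

Lemma bmeasX f n : bmeas f -> bmeas (fun x => f x ^+ n).
Proof.
move=> bf; elim: n => [|n IHn]; first exact: (bmeas_cst 1).
rewrite (_ : (fun _ => _) = (fun x => f x * f x ^+ n)); first exact: bmeasM.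
by apply/funext => x; rewrite exprS.
Qed.

Lemma bmeasV f (c : R) : 0 < c -> (forall x, c%:C%C <= `|f x|) -> bmeas f ->
  bmeas (fun x => (f x)^-1).
Proof.
move=> c0 cf [f1 f2 _].
(* The reciprocal of the squared modulus is written as a real power to inherit the measurability of
   power functions. *)
pose n2 x : R := (complex.Re (f x) ^+ 2 + complex.Im (f x) ^+ 2) `^ (-1).
have mn2 : measurable_fun setT n2.
  apply: (@measurableT_comp _ _ _ _ _ _ (fun x : R => x `^ (-1))%R) => //.
  by apply: measurable_funD; exact: measurable_funX.
have n2E x : n2 x = (complex.Re (f x) ^+ 2 + complex.Im (f x) ^+ 2)^-1.
  by rewrite /n2 powR_inv1// addr_ge0// sqr_ge0.
split.
- rewrite (_ : (fun _ => _) = (fun x => complex.Re (f x)) \* n2).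
    exact: measurable_funM.
  by apply/funext => x /=; rewrite n2E; case: (f x).
- rewrite (_ : (fun _ => _) = (fun x => - (complex.Im (f x) * n2 x))).
    by apply: measurableT_comp => //; exact: measurable_funM.
  by apply/funext => x /=; rewrite n2E; case: (f x).
- have cC : 0 < c%:C%C :> R[i] by rewrite ltcR.
  exists c^-1 => x; rewrite normfV fmorphV lef_pV2 ?cf// posrE//.
  exact: lt_le_trans (cf x).
Qed.

Lemma normRe_le (z : R[i]) (B : R) : `|z| <= B%:C%C -> `|complex.Re z| <= B.
Proof. by rewrite -lecR; apply: le_trans; exact: normc_ge_Re. Qed.

Lemma normIm_le (z : R[i]) (B : R) : `|z| <= B%:C%C -> `|complex.Im z| <= B.
Proof. by rewrite -lecR; apply: le_trans; exact: normc_ge_Im. Qed.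

Section Integral.
Variable mu : {finite_measure set T -> \bar R}.

Lemma bmeas_cintegrable f : bmeas f -> cintegrable mu f.
Proof.
move=> [f1 f2 [B fB]].
have bnd (h : T -> R) : measurable_fun setT h ->
    (forall x, `|h x| <= B) -> mu.-integrable setT (EFin \o h).
  move=> mh hB; apply: measurable_bounded_integrable => //.
    exact: fin_num_fun_lty.
  exists (B); split; first exact: num_real.
  by move=> M BM x _; apply: le_trans (hB x) _; exact: ltW.
by split; apply: bnd => // x; [exact: normRe_le|exact: normIm_le].
Qed.

(** The constant must not depend on [f]: it bounds all remainders at once. Real and imaginary parts
    each contribute [B] times the total mass. *)
Lemma cint_bound (B : R) : exists C, forall f,
  bmeas f -> (forall x, `|f x| <= B%:C%C) ->
  `|cint mu f| <= C.
Proof.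
pose m := B * fine (mu setT).
exists ((m + m)%:C)%C => f bf fB; have [i1 i2] := bmeas_cintegrable bf.
have bnd (h : T -> R) : mu.-integrable setT (EFin \o h) ->
    (forall x, `|h x| <= B) -> `|\int[mu]_x h x| <= m.
  move=> ih hB; apply: le_trans (le_normr_Rintegral _ ih) _ => //.
  rewrite /m -Rintegral_cst//; apply: le_Rintegral => //.
    exact: integrable_norm.
  by apply: (bmeas_cintegrable (bmeas_cst B%:C%C)).1.
rewrite [cint _ _]complexE /cint /=; apply: le_trans (ler_normD _ _) _.
rewrite normrM.
have -> : `|'i%C| = 1 :> R[i] by rewrite complexiE normCi.
rewrite mul1r rmorphD lerD//.
  by rewrite normc_def expr0n addr0 sqrtr_sqr lecR bnd// => x; exact: normRe_le.
by rewrite normc_def expr0n addr0 sqrtr_sqr lecR bnd// => x; exact: normIm_le.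
Qed.

Lemma cint_conj f : bmeas f -> cint mu (fun x => (f x)^*) = (cint mu f)^*.
Proof.
move=> /bmeas_cintegrable[_ i2]; apply/eqP; rewrite eq_complex /cint /=.
apply/andP; split; apply/eqP.
  by apply: eq_Rintegral => x _; case: (f x).
rewrite -mulN1r -RintegralZl//; apply: eq_Rintegral => x _.
by rewrite mulN1r; case: (f x).
Qed.

End Integral.
End BoundedMeasurable.

(** * Multiplication operators on L2 *)

Section Multiplication.
Context d (T : measurableType d) (R : realType).
Variable mu : {finite_measure set T -> \bar R}.
Implicit Types f g h : T -> R[i].

Let sqintMr (h : T -> R) f : measurable_fun setT h -> (forall x, `|h x| <= 1) ->
  f \in sqint mu -> (fun x => (h x)%:C%C * f x) \in sqint mu.
Proof.
move=> mh h1 /andP[f1 f2]; apply/andP; split.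
- rewrite (_ : _ \o _ = (fun x => h x * complex.Re (f x))).
    exact: Lfun2M.
  by apply/funext => x /=; case: (f x) => a b /=; rewrite mul0r subr0.
- rewrite (_ : _ \o _ = (fun x => h x * complex.Im (f x))).
    exact: Lfun2M.
  by apply/funext => x /=; case: (f x) => a b /=; rewrite mul0r addr0.
Qed.

Lemma sqintM h f : bmeas h -> f \in sqint mu ->
  (fun x => h x * f x) \in sqint mu.
Proof.
move=> [h1 h2 [B hB]] sf.
(* Dividing by [c] brings both parts of [h] below 1, as [Lfun2M] requires; the added 1 keeps [c]
   positive. *)
pose c := `|B| + 1.
have c0 : 0 < c by rewrite ltr_wpDl.
have scaled (k : T -> R) : measurable_fun setT k -> (forall x, `|k x| <= B) ->
    (fun x => (k x / c)%:C%C * f x) \in sqint mu.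
  move=> mk kB; apply: sqintMr => // [|x]; first exact: measurable_funM.
  rewrite normrM normfV (gtr0_norm c0) ler_pdivrMr// mul1r.
  by rewrite (le_trans (kB x))// (le_trans (ler_norm B))// lerDl.
have s1 := scaled _ h1 (fun x => normRe_le (hB x)).
have s2 := scaled _ h2 (fun x => normIm_le (hB x)).
have cC0 : (c%:C)%C != 0 :> R[i] by rewrite gt_eqF// ltcR.
rewrite (_ : (fun _ => _) =
    (c%:C : R[i])%C *: (fun x => (complex.Re (h x) / c)%:C%C * f x) +
    (c%:C%C * 'i%C) *: (fun x => (complex.Im (h x) / c)%:C%C * f x)).
  by apply: rpredD; apply: rpredZ; [exact: s1|exact: s2].
apply/funext => x.
rewrite -[RHS]/(c%:C%C * ((complex.Re (h x) / c)%:C%C * f x) +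
  (c%:C%C * 'i%C) * ((complex.Im (h x) / c)%:C%C * f x)).
rewrite [h x in LHS]complexE !rmorphM !fmorphV /=.
by field.
Qed.

(* The default value 0 of insubd is never reached for bounded measurable h. *)
Definition mulfun h (f : L2fun mu) : L2fun mu :=
  insubd (0 : L2fun mu) (fun x => h x * f x).

Lemma mulfunE h (f : L2fun mu) x : bmeas h -> mulfun h f x = h x * f x.
Proof. by move=> bh; rewrite val_insubd sqintM//; exact: valP. Qed.

Definition mulop h (u : L2 mu) : L2 mu := L2class (mulfun h (L2repr u)).

Lemma mulopC h (f : L2fun mu) : bmeas h ->
  mulop h (L2class f) = L2class (mulfun h f).
Proof.
move=> bh; apply/L2classE; have := L2classK f; apply: filterS => x /= fx _.
by rewrite !mulfunE// fx.
Qed.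

Lemma mulopP h a u v : bmeas h ->
  mulop h (a *: u + v) = a *: mulop h u + mulop h v.
Proof.
move=> bh; rewrite -[u]L2reprK -[v]L2reprK -[_ *: L2class _]L2classZ -L2classD.
rewrite !mulopC// -[_ *: L2class _]L2classZ -L2classD; congr L2class.
apply/val_inj/funext => x.
rewrite -[RHS]/(a * mulfun h (L2repr u) x + mulfun h (L2repr v) x) !mulfunE//.
rewrite [LHS]mulfunE// -[LHS]/(h x * (a * L2repr u x + L2repr v x)); ring.
Qed.

Lemma mulopM g h u : bmeas g -> bmeas h ->
  mulop g (mulop h u) = mulop (fun x => g x * h x) u.
Proof.
move=> bg bh; rewrite -[u]L2reprK !mulopC//; last exact: bmeasM.
congr L2class; apply/val_inj/funext => x; rewrite [LHS]mulfunE// mulfunE//.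
by rewrite [RHS]mulfunE ?mulrA//; exact: bmeasM.
Qed.

Lemma mulopZD a g h u : bmeas g -> bmeas h ->
  mulop (fun x => g x + a * h x) u = mulop g u + a *: mulop h u.
Proof.
move=> bg bh; have bgh := bmeasD bg (bmeasM (bmeas_cst T a) bh).
rewrite -[u]L2reprK !mulopC// -[_ *: L2class _]L2classZ -L2classD.
congr L2class; apply/val_inj/funext => x.
rewrite -[RHS]/(mulfun g (L2repr u) x + a * mulfun h (L2repr u) x).
by rewrite [LHS]mulfunE// !mulfunE// mulrDl mulrA.
Qed.

Lemma mulop1 u : mulop (fun=> 1) u = u.
Proof.
rewrite -[u in RHS]L2reprK; congr L2class; apply/val_inj/funext => x.
by rewrite [LHS]mulfunE ?mul1r//; exact: bmeas_cst.
Qed.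

Lemma dot_mulop h u v : bmeas h ->
  L2dot (mulop h u) v = L2dot u (mulop (fun x => (h x)^*) v).
Proof.
move=> bh; have bh' := bmeas_conj bh.
rewrite -[u]L2reprK -[v]L2reprK !mulopC// !L2dotE; congr cint.
by apply/funext => x /=; rewrite !mulfunE// rmorphM /= conjCK; ring.
Qed.

End Multiplication.

(** * The Cauchy kernel *)

Section CauchyKernel.
Context (R : realType).
Implicit Types x : torus R.

Lemma bmeas_xi : bmeas (@xi R).
Proof.
split; [exact: measurable_Re_xi|exact: measurable_Im_xi|].
by exists 1 => x; rewrite norm_xi.
Qed.

Lemma xi_conjK x : (xi x)^* * xi x = 1.
Proof. by rewrite mulrC -normCK norm_xi expr1n. Qed.

Variable z : R[i].
Hypothesis z1 : `|z| < 1.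

Definition cker x : R[i] := (1 - (xi x)^* * z)^-1.

Let den_ge x : 1 - `|z| <= `|1 - (xi x)^* * z|.
Proof.
have zE : `|(xi x)^* * z| = `|z| by rewrite normrM norm_conjC norm_xi mul1r.
by have := lerB_dist 1 ((xi x)^* * z); rewrite zE normr1.
Qed.

Lemma cker_den x : 1 - (xi x)^* * z != 0.
Proof. by rewrite -normr_gt0 (lt_le_trans _ (den_ge x))// subr_gt0. Qed.

Lemma bmeas_cker : bmeas cker.
Proof.
have zE : (complex.Re `|z|)%:C%C = `|z| by rewrite RRe_real.
apply: (@bmeasV _ _ _ _ (1 - complex.Re `|z|)).
- by rewrite subr_gt0 -ltcR zE.
- by move=> x; rewrite rmorphB rmorph1 /= zE.
- apply: bmeasD (bmeas_cst _ 1) _.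
  rewrite (_ : (fun _ => _) = (fun x => (xi x)^* * - z)).
    by apply: bmeasM (bmeas_cst _ _); exact: bmeas_conj bmeas_xi.
  by apply/funext => x; rewrite mulrN.
Qed.

(* The kernel maps the disc into the half-plane to the right of 1/2. *)
Lemma cker_Re x : 2^-1 <= complex.Re (cker x).
Proof.
suff : (1 : R[i]) <= cker x + (cker x)^*.
  rewrite addcJ => h.
  have : ((1 : R)%:C <= (2 * complex.Re (cker x))%:C)%C.
    by rewrite rmorphM rmorph_nat.
  by rewrite lecR -ler_pdivrMl// mulr1.
rewrite -subr_ge0; set u := (xi x)^* * z.
(* The left side is the Poisson kernel. *)
have -> : cker x + (cker x)^* - 1 = (1 - `|z| ^+ 2) * (cker x * (cker x)^*).
  have d0 := cker_den x; rewrite -/u in d0.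
  have d0' : 1 - u^* != 0 by rewrite -(rmorph1 Num.conj) -rmorphB fmorph_eq0.
  have -> : `|z| ^+ 2 = u * u^*.
    by rewrite -normCK /u normrM norm_conjC norm_xi mul1r.
  rewrite /cker -/u fmorphV rmorphB rmorph1; field.
  by rewrite d0 d0'.
rewrite mulr_ge0//; last by rewrite mul_conjC_ge0.
by rewrite subr_ge0 expr_le1// ltW.
Qed.

Lemma cint_cker_neq0 (mu : probability (torus R) R) : cint mu cker != 0.
Proof.
have [i1 _] := bmeas_cintegrable mu bmeas_cker.
have : (2^-1 : R) <= complex.Re (cint mu cker).
  rewrite /cint /= -[2^-1]mulr1 -[X in _ * X](_ : fine (mu setT) = 1);
    last first.
    by rewrite probability_setT.
  rewrite -Rintegral_cst//; apply: le_Rintegral => //.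
    exact: (bmeas_cintegrable mu (bmeas_cst _ (2^-1)%:C%C)).1.
  by move=> x _; exact: cker_Re.
move=> h; apply/eqP => h0; move: h; rewrite h0 /=.
by rewrite lt_geF// invr_gt0.
Qed.

End CauchyKernel.

(** * Finite geometric expansion of the conjugated Cauchy integral *)

Section Truncation.
Context (R : realType).
Variables (nu : {finite_measure set (torus R) -> \bar R}) (z : R[i]).
Hypothesis z1 : `|z| < 1.

Let q (x : torus R) := (cker z x)^*.

Let bq : bmeas q. Proof. exact: bmeas_conj (bmeas_cker z1). Qed.

(** Iterates [q = 1 + z^* xi q]. Conjugating the kernel yields nonnegative powers of [xi], which
    match the forward iterates of [Ugamma g]. *)
Lemma cint_cker_expansion N : cint nu q =
  \sum_(n < N) z^* ^+ n * cint nu (fun x => xi x ^+ n) +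
  z^* ^+ N * cint nu (fun x => xi x ^+ N * q x).
Proof.
elim: N => [|N IHN].
  rewrite big_ord0 add0r mul1r; congr cint.
  by apply/funext => x; rewrite mul1r.
rewrite IHN big_ord_recr /= -addrA; congr (_ + _).
rewrite exprSr -mulrA -mulrDr; congr (_ * _).
rewrite -cintZ -?cintD.
- congr cint; apply/funext => x /=.
  rewrite exprSr; suff {1}-> : q x = 1 + z^* * xi x * q x by ring.
  have d0 := cker_den z1 x.
  have d0' : 1 - xi x * z^* != 0.
    move: d0; rewrite -(fmorph_eq0 (@Num.conj R[i])) rmorphB rmorph1 rmorphM /=.
    by rewrite conjCK.
  by rewrite /q /cker fmorphV rmorphB rmorph1 rmorphM /= conjCK; field.
- exact: bmeas_cintegrable (bmeasX _ (bmeas_xi R)).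
- apply: bmeas_cintegrable; apply: bmeasM (bmeas_cst _ _) _.
  by apply: bmeasM bq; apply: bmeasX; exact: bmeas_xi.
- by apply: bmeas_cintegrable; apply: bmeasM bq; apply: bmeasX; exact: bmeas_xi.
Qed.

(** The factor [xi x ^+ N] is unimodular, so a bound for [q] serves every [N]. *)
Lemma cint_cker_remainder :
  exists B, forall N, `|cint nu (fun x => xi x ^+ N * q x)| <= B.
Proof.
have [_ _ [B qB]] := bq; have [C hC] := cint_bound nu B.
exists C => N; apply: hC.
  by apply: bmeasM bq; apply: bmeasX; exact: bmeas_xi.
by move=> x; rewrite normrM normrX norm_xi expr1n mul1r.
Qed.

End Truncation.

(** * Clark measures *)

Section Clark.
Context (R : realType).
Variable mu : probability (torus R) R.

Let dot : {dot L2 mu for @Num.conj R[i]} := @L2dot _ _ _ mu.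
Let M : L2 mu -> L2 mu := mulop (@xi R).
Let Ms : L2 mu -> L2 mu := mulop (fun x => (xi x)^*).
Let e : L2 mu := one_xi mu.

Let bxi := @bmeas_xi R.
Let bxic := bmeas_conj bxi.

Let MK : cancel M Ms.
Proof.
move=> u; rewrite /M /Ms mulopM// -[RHS]mulop1; congr mulop.
by apply/funext => x; rewrite xi_conjK.
Qed.

Let MsK : cancel Ms M.
Proof.
move=> u; rewrite /M /Ms mulopM// -[RHS]mulop1; congr mulop.
by apply/funext => x; rewrite mulrC xi_conjK.
Qed.

Let MP a x y : M (a *: x + y) = a *: M x + M y. Proof. exact: mulopP. Qed.
Let MsP a x y : Ms (a *: x + y) = a *: Ms x + Ms y. Proof. exact: mulopP. Qed.
Let dotM x y : dot (M x) y = dot x (Ms y). Proof. exact: dot_mulop. Qed.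

(** Converts the scalar products of the abstract argument into Cauchy integrals. *)
Lemma dot_mulop_one h : bmeas h -> L2dot (mulop h e) e = cint mu h.
Proof.
move=> bh; rewrite mulopC// L2dotE; congr cint; apply/funext => x.
by rewrite mulfunE//= conjC1 !mulr1.
Qed.

Let e1 : dot e e = 1.
Proof.
rewrite -[e in dot e _]mulop1 [LHS]dot_mulop_one; last exact: bmeas_cst.
have mT : fine (mu setT) = 1 by rewrite probability_setT.
by rewrite /cint /= !Rintegral_cst// mul1r mul0r mT.
Qed.

Let xi_barE : xi_bar mu = Ms e.
Proof.
rewrite /Ms mulopC//; congr L2class; apply/val_inj/funext => x.
by rewrite [RHS]mulfunE// mulr1.
Qed.

Let M_xiE u : M_xi u = M u.
Proof.
by congr L2class; apply/val_inj/funext => x; rewrite [RHS]mulfunE.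
Qed.

Let U0E : @U0 _ mu = fun u => M u - dot u (Ms e) *: e.
Proof. by apply/funext => u; rewrite /U0 M_xiE xi_barE. Qed.

(** * The resolvent of [Ms] as multiplication by the Cauchy kernel *)

Variable z : R[i].
Hypothesis z1 : `|z| < 1.

Let bS := bmeas_cker z1.

Let S : L2 mu -> L2 mu := mulop (cker z).

Let cker_mul : (fun x => cker z x * (1 + - z * (xi x)^*)) = fun=> 1.
Proof.
apply/funext => x; rewrite /cker mulNr [z * _]mulrC mulVf//.
exact: cker_den.
Qed.

Let resolvent_den u : u - z *: Ms u = mulop (fun x => 1 + - z * (xi x)^*) u.
Proof.
by rewrite mulopZD// ?mulop1 ?scaleNr//; exact: bmeas_cst.
Qed.

Let bden : bmeas (fun x => 1 + - z * (xi x)^*).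
Proof. by apply: bmeasD (bmeas_cst _ 1) _; exact: bmeasM (bmeas_cst _ _) _. Qed.

Let SK u : S (u - z *: Ms u) = u.
Proof. by rewrite resolvent_den /S mulopM// cker_mul mulop1. Qed.

Let KS u : S u - z *: Ms (S u) = u.
Proof.
rewrite resolvent_den /S mulopM// -[RHS]mulop1 -cker_mul; congr mulop.
by apply/funext => x; rewrite mulrC.
Qed.

Let SP a x y : S (a *: x + y) = a *: S x + S y. Proof. exact: mulopP. Qed.

Let K := cint mu (cker z).

Let dotS : dot (S e) e = K. Proof. exact: dot_mulop_one. Qed.

Let cauchyT1 (nu : {measure set (torus R) -> \bar R}) :
  cauchyT nu (fun=> 1) z = cint nu (cker z).
Proof. by congr cint; apply/funext => x; rewrite mul1r. Qed.

Lemma theta_ncauchyT : theta mu z = z * ncauchyT mu (fun x => (xi x)^*) z.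
Proof.
have S0 : dot (S e) e != 0 by rewrite dotS cint_cker_neq0.
have := charop_pert MK MsK MP MsP dotM e1 SP SK KS S0.
rewrite -U0E -xi_barE dotS.
have -> : dot (S (xi_bar mu)) e = cauchyT mu (fun x => (xi x)^*) z.
  rewrite xi_barE /S /Ms mulopM// [LHS]dot_mulop_one; last exact: bmeasM.
  by congr cint; apply/funext => x; rewrite mulrC.
rewrite /K -cauchyT1 => chE; apply: xget_unique => // w wE.
(* [theta] is selected by description; since [e] is nonzero, the coefficient of [e] is unique. *)
have e0 : e != 0 by rewrite -(dnorm_eq0 dot) e1 oner_neq0.
move: chE; rewrite [LHS]wE => /eqP; rewrite -subr_eq0 -scalerBl scaler_eq0.
by rewrite (negPf e0) orbF subr_eq0 => /eqP.
Qed.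

(** Pointwise, [z (xi x)^* / (1 - (xi x)^* z)] is [cker z x - 1]. *)
Lemma cauchyT_xibar (nu : {finite_measure set (torus R) -> \bar R}) :
  z * cauchyT nu (fun x => (xi x)^*) z =
  cauchyT nu (fun=> 1) z - cint nu (fun=> 1).
Proof.
have b1 := bmeas_cst (torus R) (1 : R[i]).
rewrite cauchyT1 -mulN1r -!cintZ -?cintD; try exact: bmeas_cintegrable.
- congr cint; apply/funext => x /=; rewrite /cker.
  by field; exact: cker_den.
- exact: bmeas_cintegrable (bmeas_cst _ _).
- exact: bmeas_cintegrable (bmeasM bxic bS).
Qed.

(** * Comparison of the Cauchy transforms of [mu] and the spectral measure *)

Section SpectralMeasure.
Variables (g : R[i]) (nu : {finite_measure set (torus R) -> \bar R}).
Hypothesis g1 : `|g| = 1.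
Hypothesis nu_spec : is_spectral_measure dot (Ugamma g) e nu.

Let moment n : cint nu (fun x => xi x ^+ n) = dot (iter n (Ugamma g) e) e.
Proof. exact: (nu_spec n%:Z). Qed.

Let UE x : Ugamma g x = M x + ((g - 1) * dot x (Ms e)) *: e.
Proof.
rewrite /Ugamma U0E -addrA -scaleNr -scalerDl -xi_barE.
by congr (_ + _ *: _); rewrite mulrBl mul1r addrC.
Qed.

Let w : L2 mu := mulop (fun x => (cker z x)^*) e.

Let wE : w - z^* *: M w = e.
Proof.
have bq := bmeas_conj bS.
rewrite /w /M mulopM// -scaleNr -mulopZD//; last exact: bmeasM.
rewrite -[RHS]mulop1; congr mulop; apply/funext => x.
transitivity ((cker z x * (1 + - z * (xi x)^*))^*).
  by rewrite rmorphM rmorphD rmorph1 rmorphM rmorphN /= conjCK; ring.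
by rewrite (congr1 (fun f => f x) cker_mul) conjC1.
Qed.

Let dotw : dot w e = K^*.
Proof. by rewrite [LHS]dot_mulop_one ?cint_conj//; exact: bmeas_conj. Qed.

Let G := cint nu (cker z).

(* Both sides have the same power series in the conjugate of z, since the
   coefficients of G are the moments of nu; the N-th remainders are compared. *)
Lemma cauchy_perturbed : K^* = (1 - (g - 1) * (K^* - 1)) * G^*.
Proof.
set k := 1 - _.
have [B hB] := cint_cker_remainder nu z1.
apply/eqP; rewrite -subr_eq0 -normr_eq0; apply/eqP.
(* The first summand bounds the operator remainder by the norm of [w], the second bounds [k] times
   the remainder of the integral expansion. *)
apply: (@geometric_bound_eq0 _ _ `|z| (sqrtC (dot w w) + `|k| * B)) => // N.
have := resolvent_expansion MP dotM e1 UE wE N; rewrite dotw -/k => ->.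
have := cint_cker_expansion nu z1 N; rewrite cint_conj// -/G => ->.
under eq_bigr do rewrite -moment.
rewrite mulrDr opprD addrACA subrr add0r mulrCA -mulrBr normrM normrX.
rewrite norm_conjC.
rewrite ler_wpM2l ?exprn_ge0// (le_trans (ler_normB _ _))// lerD//.
  rewrite -(ler_pXn2r (n := 2)) ?nnegrE ?sqrtC_ge0 ?dnorm_ge0// sqrtCK.
  refine (resolvent_remainder MK dotM e1 g1 UE w N).
by rewrite normrM ler_wpM2l.
Qed.

Lemma theta_perturbed : theta mu z = g * z * ncauchyT nu (fun x => (xi x)^*) z.
Proof.
have K0 : K != 0 by exact: cint_cker_neq0.
have gg : g * g^* = 1 by rewrite -normCK g1 expr1n.
have KG : K = (1 - (g^* - 1) * (K - 1)) * G.
  apply: (can_inj (@conjCK R[i])); rewrite {1}cauchy_perturbed.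
  by rewrite rmorphM !(rmorphB, rmorphM, rmorph1) /= conjCK.
(* [nu] is only given as a finite measure: [G != 0] is inherited from [K], and the total mass 1 is
   the zeroth moment. *)
have G0 : G != 0.
  by apply/eqP => G0; move/eqP: K0; apply; rewrite KG G0 mulr0.
have nu1 : cint nu (fun=> 1) = 1 by have := moment 0; rewrite /= e1.
have mu1 : cint mu (fun=> 1) = 1.
  by rewrite -dot_mulop_one; [rewrite mulop1; exact: e1|exact: bmeas_cst].
(* Rearranging [KG]; multiplied by [g] and divided by [K G], this reads
   [(K - 1) / K = g (G - 1) / G]. *)
have KGg : g^* * ((K - 1) * G) = K * (G - 1).
  transitivity (K * G - (1 - (g^* - 1) * (K - 1)) * G); first by ring.
  by rewrite -KG mulrBr mulr1.
rewrite theta_ncauchyT /ncauchyT -(mulrA g z) !(mulrA z).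
rewrite !cauchyT_xibar nu1 mu1 !cauchyT1 -/K -/G.
apply: (mulIf K0); rewrite mulfVK//; apply: (mulIf G0).
transitivity (g * (g^* * ((K - 1) * G))); first by rewrite mulrA gg mul1r.
by rewrite KGg; field.
Qed.

End SpectralMeasure.
End Clark.

Theorem theorem5p3 (R : realType) (mu : probability (torus R) R) :
  forall z : R[i], `|z| < 1 ->
    theta mu z = z * ncauchyT mu (fun x => (xi x)^* ) z /\
    forall (g : R[i]) (mu_g : {finite_measure set (torus R) -> \bar R}),
      `|g| = 1 ->
      is_spectral_measure (@L2dot _ _ _ mu) (Ugamma g) (one_xi mu) mu_g ->
      theta mu z = g * z * ncauchyT mu_g (fun x => (xi x)^* ) z.
Proof.
move=> z z1; split; first exact: theta_ncauchyT.
by move=> g nu g1 nu_spec; exact: theta_perturbed.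
Qed.
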